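(* Let $G$ be a graph and $k$ a nonnegative integer such that $|N(u)\setminus N[v]|\geq k$ for all $u,v\in V(G)$. Then $\mathrm{thin}(G)\geq k+1$. Moreover, for every ordering $<$ of $V(G)$, the first $k+1$ vertices in the ordering induce a complete graph in $G_<$.
   Context: Graphs are finite, simple, undirected. $N(v)$ is the open neighborhood of $v$ and $N[v]=N(v)\cup\{v\}$. For a graph $G=(V,E)$, an ordering $v_1,\dots,v_n$ of $V$ and a partition of $V$ are consistent if for every $r<s<t$, whenever $v_r,v_s$ are in the same class and $v_tv_r\in E$, then $v_tv_s\in E$. $\mathrm{thin}(G)$ is the minimum number of classes of a partition of $V$ consistent with some ordering of $V$. For an ordering $<$ of $V(G)$, $G_<$ is the graph with vertex set $V(G)$ in which, for $v<w$, $vw$ is an edge iff there is a vertex $z$ with $w<z$, $zv\in E(G)$ and $zw\notin E(G)$.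
   Formalization: The condition is required only for distinct u, v (with u = v it would force k = 0); G is assumed nonempty, since the empty graph has thin(G) = 0 and violates the bound; and k = 0 is assumed when G has exactly one vertex. *)

(* Defs.v *)
From mathcomp Require Import all_boot.
Set Implicit Arguments.
Unset Strict Implicit.
Unset Printing Implicit Defensive.

Record sgraph := SGraph {
  vertex :> finType;
  edge : rel vertex;
  edge_sym : symmetric edge;
  edge_irr : irreflexive edge }.

Definition open_nbhd (G : sgraph) (v : G) : {set G} := [set w | edge v w].
Definition closed_nbhd (G : sgraph) (v : G) : {set G} := v |: open_nbhd v.

(* A duplicate-free tuple of length #|V| lists every element of V exactly once,
   so such tuples s are exactly the orderings v_1, ..., v_n of V, with
   tnth s i = v_(i+1). *)
Definition ordering (V : finType) (s : #|V|.-tuple V) : bool := uniq s.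

Definition precedes (V : finType) (s : #|V|.-tuple V) (v w : V) : bool :=
  index v s < index w s.

Definition first_vertices (V : finType) (s : #|V|.-tuple V) (m : nat) :
  {set V} := [set x in take m s].

Definition consistent (G : sgraph) (s : #|G|.-tuple G) (P : {set {set G}}) :
  bool :=
  [forall r : 'I_#|G|, forall i : 'I_#|G|, forall t : 'I_#|G|,
    [&& r < i, i < t,
        [exists C in P, (tnth s r \in C) && (tnth s i \in C)]
      & edge (tnth s t) (tnth s r)]
    ==> edge (tnth s t) (tnth s i)].

Definition thin_with (G : sgraph) (m : nat) : bool :=
  [exists P : {set {set G}}, exists s : #|G|.-tuple G,
    [&& partition P [set: G], ordering s, consistent s P & #|P| == m]].

Lemma thin_with_ex (G : sgraph) : exists m, thin_with G m.
Proof.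
pose P : {set {set G}} := [set [set x] | x : G].
have sz : size (enum G) == #|G| by rewrite -cardE.
exists #|P|; apply/existsP; exists P; apply/existsP; exists (Tuple sz).
apply/and4P; split => //.
- apply/and3P; split.
  + apply/eqP/setP => x; rewrite inE; apply/bigcupP.
    by exists [set x]; [apply/imsetP; exists x | rewrite inE].
  + apply/trivIsetP => _ _ /imsetP[x _ ->] /imsetP[y _ ->] nxy.
    by rewrite disjoints1 inE; apply: contra nxy => /eqP->.
  + by apply/imsetP => -[x _ /setP/(_ x)]; rewrite !inE eqxx.
- exact: enum_uniq.
- apply/forallP => r; apply/forallP => i; apply/forallP => t.
  apply/implyP => /and4P[_ _ /exists_inP[_ /imsetP[x _ ->]]].
  by rewrite !inE => /andP[/eqP-> /eqP->].
Qed.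

Definition thin (G : sgraph) : nat := ex_minn (thin_with_ex G).

Section OrderGraph.
Variables (G : sgraph) (s : #|G|.-tuple G).

Definition order_arc (v w : G) : bool :=
  precedes s v w && [exists z : G, [&& precedes s w z, edge z v & ~~ edge z w]].

Definition order_edge : rel G := fun v w => order_arc v w || order_arc w v.

Lemma order_edge_sym : symmetric order_edge.
Proof. by move=> v w; rewrite /order_edge orbC. Qed.

Lemma order_edge_irr : irreflexive order_edge.
Proof. by move=> v; rewrite /order_edge /order_arc /precedes ltnn. Qed.

(* G_<, for the ordering < given by s *)
Definition order_graph : sgraph := SGraph order_edge_sym order_edge_irr.
End OrderGraph.

Section Induced.
Variables (G : sgraph) (A : {set G}).

Definition induced_edge : rel {x : G | x \in A} :=
  fun x y => edge (val x) (val y).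

Lemma induced_edge_sym : symmetric induced_edge.
Proof. by move=> x y; apply: edge_sym. Qed.

Lemma induced_edge_irr : irreflexive induced_edge.
Proof. by move=> x; apply: edge_irr. Qed.

Definition induced : sgraph := SGraph induced_edge_sym induced_edge_irr.
End Induced.

Definition complete (G : sgraph) : Prop :=
  forall x y : G, x != y -> edge x y.

(* Main.v *)
Require Import Defs.
From mathcomp Require Import all_boot.

(** If [v] precedes [w] among the first [k + 1] vertices, then at most [k - 1]
    vertices other than [v] precede [w]; so one of the [k] vertices of
    [N(v) \ N[w]], which contains neither [v] nor [w], comes after [w], and [vw]
    is an edge of [G_<]. Adjacent vertices of [G_<] lie in distinct classes of
    every partition consistent with [<], hence there are at least [k + 1]
    classes. *)

(** A duplicate-free list inside [enum V] that is at least as long has the same members. *)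
Lemma mem_ordering (V : finType) (s : #|V|.-tuple V) (x : V) :
  ordering s -> x \in tval s.
Proof.
move=> us.
have /uniq_min_size -> // : {subset s <= enum V} by move=> y; rewrite mem_enum.
  by rewrite mem_enum.
by rewrite -cardE size_tuple.
Qed.

Lemma mem_first_vertices (V : finType) (s : #|V|.-tuple V) (m : nat) (x : V) :
  ordering s -> (x \in first_vertices s m) = (index x s < m).
Proof. by move=> us; rewrite inE in_take // mem_ordering. Qed.

Lemma card_first_vertices (V : finType) (s : #|V|.-tuple V) (m : nat) :
  ordering s -> m <= #|V| -> #|first_vertices s m| = m.
Proof.
move=> us lem; rewrite cardsE (card_uniqP (take_uniq _ us)).
by rewrite size_takel // size_tuple.
Qed.

Lemma precedes_total (V : finType) (s : #|V|.-tuple V) (x y : V) :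
  ordering s -> x != y -> precedes s x y || precedes s y x.
Proof.
move=> us; rewrite /precedes -neq_ltn; apply: contra => /eqP eqi.
by rewrite -(nth_index x (mem_ordering _ _ x us)) eqi nth_index // mem_ordering.
Qed.

(** [index w s] counts the vertices before [w], including [v]. If no [z] after [w] gives the arc,
    the difference lies among these vertices without [v], so it has fewer than [index w s]
    elements. *)
Lemma order_arc_large_diff (G : sgraph) (s : #|G|.-tuple G) (v w : G) :
  ordering s -> precedes s v w ->
  index w s <= #|open_nbhd v :\: closed_nbhd w| -> order_arc s v w.
Proof.
move=> us ltvw lewD; rewrite /order_arc ltvw /=; apply: contraLR lewD.
rewrite -ltnNge => /existsPn noz.
have vw : v \in first_vertices s (index w s) by rewrite mem_first_vertices.
have lew : index w s <= #|G| by rewrite -[X in _ <= X](size_tuple s) index_size.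
rewrite -(card_first_vertices _ _ _ us lew).
rewrite (cardsD1 v (first_vertices _ _)) vw add1n ltnS.
apply/subset_leq_card/subsetP => z.
rewrite [z \in _]inE !in_setU1 !inE negb_or => /andP[/andP[zw nwz] vz].
apply/andP; split.
  by apply: contraTneq vz => ->; rewrite edge_irr.
rewrite in_take ?mem_ordering //.
(* A [z] after [w] would be a witness for the arc. *)
case/orP: (precedes_total _ _ _ _ us zw) => // ltwz.
by have := noz z; rewrite ltwz edge_sym vz edge_sym nwz.
Qed.

Lemma order_edge_first_vertices (G : sgraph) (k : nat) (s : #|G|.-tuple G) :
  (forall u v : G, u != v -> k <= #|open_nbhd u :\: closed_nbhd v|) ->
  ordering s ->
  {in first_vertices s k.+1 &, forall x y, x != y -> order_edge s x y}.
Proof.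
move=> hk us x y; rewrite !mem_first_vertices // !ltnS => lex ley nxy.
have leD u v : index v s <= k -> u != v ->
    index v s <= #|open_nbhd u :\: closed_nbhd v|.
  by move=> lev /hk; apply: leq_trans.
apply/orP; case/orP: (precedes_total _ _ _ _ us nxy) => lt; [left | right].
  by apply: order_arc_large_diff => //; apply: leD.
by apply: order_arc_large_diff => //; apply: leD; rewrite // eq_sym.
Qed.

Lemma consistent_order_arc (G : sgraph) (s : #|G|.-tuple G)
    (P : {set {set G}}) (v w : G) :
  partition P [set: G] -> ordering s -> consistent s P ->
  order_arc s v w -> pblock P v != pblock P w.
Proof.
move=> partP us cons /andP[ltvw /existsP[z /and3P[ltwz zv]]].
apply: contraNneq => eqB.
have inP x : x \in cover P by rewrite (cover_partition partP) inE.
have ltG x : index x s < #|G|.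
  by rewrite -[X in _ < X](size_tuple s) index_mem mem_ordering.
have tnthE x : tnth s (Ordinal (ltG x)) = x.
  by rewrite (tnth_nth x) nth_index // mem_ordering.
(* If [v] and [w] shared a class, consistency at the positions of [v], [w], [z] would turn the edge
   [zv] into an edge [zw]. *)
move/forallP/(_ (Ordinal (ltG v)))/forallP/(_ (Ordinal (ltG w))): cons.
move/forallP/(_ (Ordinal (ltG z)))/implyP; rewrite !tnthE; apply.
apply/and4P; split => //; apply/exists_inP.
by exists (pblock P v); rewrite ?pblock_mem // {2}eqB !mem_pblock !inP.
Qed.

Lemma leq_thin (G : sgraph) (m : nat) :
  (forall (s : #|G|.-tuple G) (P : {set {set G}}), partition P [set: G] ->
     ordering s -> consistent s P -> m <= #|P|) ->
  m <= thin G.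
Proof.
move=> lem; rewrite /thin; case: ex_minnP => n /existsP[P /existsP[s]].
by case/and4P=> partP us cons /eqP <- _; apply: (lem s).
Qed.

(** Sending each vertex to its class is injective on a clique of the order graph. *)
Lemma clique_order_graph_leq_card (G : sgraph) (s : #|G|.-tuple G)
    (P : {set {set G}}) (A : {set G}) :
  partition P [set: G] -> ordering s -> consistent s P ->
  {in A &, forall x y, x != y -> order_edge s x y} -> #|A| <= #|P|.
Proof.
move=> partP us cons cliqueA.
have inj : {in A &, injective (pblock P)}.
  move=> x y xA yA eqB; apply/eqP; apply: contraT => /(cliqueA _ _ xA yA).
  by case/orP=> /(consistent_order_arc _ _ _ _ _ partP us cons); rewrite eqB eqxx.
rewrite -(card_in_imset inj); apply/subset_leq_card/subsetP => _ /imsetP[x _ ->].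
by rewrite pblock_mem // (cover_partition partP) inE.
Qed.

(** The difference misses [u], which is not its own neighbor. *)
Lemma card_nbhd_diff_lt (G : sgraph) (u v : G) :
  #|open_nbhd u :\: closed_nbhd v| < #|G|.
Proof.
rewrite -cardsT; apply: proper_card; rewrite properT.
by apply: contraTneq (in_setT u) => <-; rewrite !inE edge_irr andbF.
Qed.

(** For [u = v] the difference is empty, so [hk] ranges over distinct pairs. It is then vacuous on a
    single vertex, where [G_single] bounds [k]. *)
Theorem theorem3p7 (G : sgraph) (k : nat)
    (G_nonempty : 0 < #|G|)
    (G_single : #|G| = 1 -> k = 0)
    (hk : forall u v : G, u != v -> k <= #|open_nbhd u :\: closed_nbhd v|) :
  k.+1 <= thin G /\
  (forall s : #|G|.-tuple G, ordering s ->
     complete (induced (G := order_graph s) (first_vertices s k.+1))).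
Proof.
(* This ensures that there really are [k.+1] first vertices. *)
have ltkG : k < #|G|.
  case: (ltngtP #|G| 1) G_nonempty G_single => [| /card_gt1P[u [v [_ _ uv]]] | ->].
  - by case: #|G|.
  - by move=> _ _; apply: leq_ltn_trans (hk u v uv) (card_nbhd_diff_lt _ _ _).
  - by move=> _ ->.
split.
  apply: leq_thin => s P partP us cons.
  rewrite -(card_first_vertices _ _ _ us ltkG).
  apply: (clique_order_graph_leq_card _ _ _ _ partP us cons).
  exact: order_edge_first_vertices hk us.
move=> s us [x xA] [y yA] nxy.
exact: (order_edge_first_vertices _ _ _ hk us x y xA yA nxy).
Qed.
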